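(* Let $\mathcal{E}$ be a locally Cartesian closed category with a probability monad $\mathcal{P}:\mathcal{E}\to\mathcal{E}$, and let $\mathbb{T}$ be a monoid in $\mathcal{E}$. The categories $\mathbf{RDyn}^{\mathbb{T}}(p,\theta)$ collect into a doubly-(op)indexed category $\mathbf{RDyn}^{\mathbb{T}}:\mathbf{Poly}_{\mathcal{E}}\times\mathbf{Cat}(\mathbf{B}\mathbb{T},\mathcal{E})_{\mathcal{P}}\to\mathbf{Cat}$, with the following actions. (i) For a morphism of polynomials $\varphi=(\varphi_1,\varphi^\#):p\to q$ and a closed measure-preserving system $(\theta,\beta)$, the functor $\mathbf{RDyn}^{\mathbb{T}}(\varphi,\theta):\mathbf{RDyn}^{\mathbb{T}}(p,\theta)\to\mathbf{RDyn}^{\mathbb{T}}(q,\theta)$ sends $(\pi_X:X\to\Omega,\vartheta^o,\vartheta^u)$ to $(\pi_X,\ \varphi_1\circ\vartheta^o,\ \vartheta^u\circ{\vartheta^o}^*\varphi^\#)$, where the two maps are $$\mathbb{T}\times X\xrightarrow{\vartheta^o}p(1)\xrightarrow{\varphi_1}q(1),\qquad \sum_{t:\mathbb{T}}\sum_{x:X}q[\varphi_1\circ\vartheta^o(t,x)]\xrightarrow{{\vartheta^o}^*\varphi^\#}\sum_{t:\mathbb{T}}\sum_{x:X}p[\vartheta^o(t,x)]\xrightarrow{\vartheta^u}X ,$$ and sends a morphism to the one with the same underlying map of state spaces. (ii) For a morphism $\phi:(\theta,\beta)\to(\theta',\beta')$ of closed measure-preserving systems and a polynomial $p$, the functor $\mathbf{RDyn}^{\mathbb{T}}(p,\phi):\mathbf{RDyn}^{\mathbb{T}}(p,\theta)\to\mathbf{RDyn}^{\mathbb{T}}(p,\theta')$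 sends $(\pi_X,\vartheta^o,\vartheta^u)$ to $(\phi\circ\pi_X,\vartheta^o,\vartheta^u)$ and a morphism to the one with the same underlying map of state spaces.
   Context: $\mathcal{E}$ is thought of as concrete (e.g. $\mathbf{Set}$ with the finitely-supported distribution monad), and element notation is used; $1$ is its terminal object. A polynomial in $\mathcal{E}$ is $p=\sum_{i:p(1)}y^{p[i]}$ with $y^A=\mathcal{E}(A,-)$, equivalently a bundle $\sum_{i:p(1)}p[i]\to p(1)$ with fibres $p[i]$; a section of $p$ is a section $\sigma:p(1)\to\sum_ip[i]$ of this bundle. $\mathbf{Poly}_{\mathcal{E}}$ is the category of polynomials and natural transformations; a morphism $\varphi:p\to q$ is equivalently a map $\varphi_1:p(1)\to q(1)$ together with maps $\varphi^\#_i:q[\varphi_1(i)]\to p[i]$ for $i:p(1)$, and the composite of $\varphi:p\to q$ with $\chi:q\to r$ has forwards map $\chi_1\circ\varphi_1$ and backwards maps $\varphi^\#_i\circ\chi^\#_{\varphi_1(i)}$. A probability monad is a monad $\mathcal{P}$ on $\mathcal{E}$, thought of as sending a space to the space of probability distributions on it. A closed dynamical system on $\Omega$ with time $\mathbb{T}$ is an action of $\mathbb{T}$ on $\Omega$, equivalently a functor $\theta:\mathbf{B}\mathbb{T}\to\mathcal{E}$ from the one-object category of $\mathbb{T}$ with $\theta( * )=\Omega$. A closed measure-preserving system $(\theta,\beta)$ is such a $\theta$ with $\beta:1\to\mathcal{P}\Omega$ satisfying $\mathcal{P}\theta(t)\circ\beta=\beta$ for all $t$. These are the objects of $\mathbf{Cat}(\mathbf{B}\mathbb{T},\mathcal{E})_{\mathcal{P}}$;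 a morphism $\phi:(\theta,\beta)\to(\theta',\beta')$ is a map $\phi:\theta( * )\to\theta'( * )$ in $\mathcal{E}$ preserving flow ($\phi\circ\theta(t)=\theta'(t)\circ\phi$ for all $t$) and measure ($\mathcal{P}\phi\circ\beta=\beta'$). Objects of $\mathbf{RDyn}^{\mathbb{T}}(p,\theta)$ (open random dynamical systems over $(\theta,\beta)$ on the interface $p$, with $\Omega=\theta( * )$) are triples $(\pi:S\to\Omega,\vartheta^o,\vartheta^u)$ with $\vartheta^o:\mathbb{T}\times S\to p(1)$ and $\vartheta^u:\sum_{t:\mathbb{T}}\sum_{s:S}p[\vartheta^o(t,s)]\to S$ such that, for every section $\sigma$ of $p$, the maps $\vartheta^\sigma(t):=\vartheta^u(t)\circ\vartheta^o(t)^*\sigma:S\to S$ form (with $\pi$) an object of the slice $\mathbf{Cat}(\mathbf{B}\mathbb{T},\mathcal{E})/\theta$, so that $\vartheta^\sigma$ is a closed dynamical system and $\pi\circ\vartheta^\sigma(t)=\theta(t)\circ\pi$ for all $t$; here $\vartheta^o(t)^*\sigma$ is $s\mapsto(s,\sigma(\vartheta^o(t,s)))$. A morphism $(\pi_X,\vartheta^o,\vartheta^u)\to(\pi_Y,\psi^o,\psi^u)$ is a map $f:X\to Y$ in $\mathcal{E}$ with $\pi_Y\circ f=\pi_X$ and $f\circ\vartheta^\sigma(t)=\psi^\sigma(t)\circ f$ for all $t$ and $\sigma$; identities and composition are as in $\mathcal{E}$. *)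

(* Defs.v *)
From Stdlib Require Import ssreflect ssrfun ProofIrrelevance.

Set Implicit Arguments.
Unset Strict Implicit.
Unset Printing Implicit Defensive.

Declare Scope cat_scope.
Delimit Scope cat_scope with cat.
Local Open Scope cat_scope.

Record category := Category {
  ob :> Type;
  hom : ob -> ob -> Type;
  idm : forall a, hom a a;
  comp : forall a b c, hom b c -> hom a b -> hom a c;
  comp_idl : forall a b (f : hom a b), comp (idm b) f = f;
  comp_idr : forall a b (f : hom a b), comp f (idm a) = f;
  comp_assoc : forall a b c d (h : hom c d) (g : hom b c) (f : hom a b),
    comp h (comp g f) = comp (comp h g) f }.

Arguments hom {_} _ _.
Arguments idm {_} _.
Arguments comp {_ _ _ _} _ _.
Notation "g ∘ f" := (comp g f) (at level 40, left associativity) : cat_scope.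

(* An arrow packed with its endpoints, so that arrows whose endpoints are only
   provably equal can be compared. *)
Definition arrow (C : category) (a b : C) (f : hom a b) :
  {d : C * C & hom (fst d) (snd d)} :=
  existT (fun d : C * C => hom (fst d) (snd d)) (a, b) f.

Record functor (C D : category) := Functor {
  fobj :> C -> D;
  fmap : forall a b, hom a b -> hom (fobj a) (fobj b);
  fmap_id : forall a, fmap (idm a) = idm (fobj a);
  fmap_comp : forall a b c (g : hom b c) (f : hom a b),
    fmap (g ∘ f) = fmap g ∘ fmap f }.

Arguments fmap {_ _} _ {_ _} _.

Definition functor_id (C : category) : functor C C :=
  @Functor C C (fun a => a) (fun a b f => f)
    (fun a => erefl) (fun a b c g f => erefl).

Section FunctorComp.
Variables (C D B : category) (G : functor D B) (F : functor C D).

Lemma functor_comp_id (a : C) : fmap G (fmap F (idm a)) = idm (G (F a)).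
Proof. by rewrite !fmap_id. Qed.

Lemma functor_comp_comp (a b c : C) (g : hom b c) (f : hom a b) :
  fmap G (fmap F (g ∘ f)) = fmap G (fmap F g) ∘ fmap G (fmap F f).
Proof. by rewrite !fmap_comp. Qed.

Definition functor_comp : functor C B :=
  @Functor C B (fun a => G (F a)) (fun a b f => fmap G (fmap F f))
    functor_comp_id functor_comp_comp.
End FunctorComp.

Section ProductCategory.
Variables C D : category.

Definition prod_hom (x y : C * D) : Type :=
  (hom (fst x) (fst y) * hom (snd x) (snd y))%type.

Definition prod_idm (x : C * D) : prod_hom x x := (idm (fst x), idm (snd x)).

Definition prod_comp (x y z : C * D) (g : prod_hom y z) (f : prod_hom x y) :
  prod_hom x z := (fst g ∘ fst f, snd g ∘ snd f).

Lemma prod_idl x y (f : prod_hom x y) : prod_comp (prod_idm y) f = f.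
Proof. by case: f => f1 f2; rewrite /prod_comp /= !comp_idl. Qed.

Lemma prod_idr x y (f : prod_hom x y) : prod_comp f (prod_idm x) = f.
Proof. by case: f => f1 f2; rewrite /prod_comp /= !comp_idr. Qed.

Lemma prod_assoc x y z w (h : prod_hom z w) (g : prod_hom y z)
  (f : prod_hom x y) : prod_comp h (prod_comp g f) = prod_comp (prod_comp h g) f.
Proof. by rewrite /prod_comp /= !comp_assoc. Qed.

Definition prod_cat : category :=
  @Category (C * D) prod_hom prod_idm prod_comp prod_idl prod_idr prod_assoc.
End ProductCategory.

(* A functor B -> Cat with prescribed action [fibre] on objects; Cat is the
   1-category of categories and functors, so identities and composites are
   preserved up to equality of functors. *)
Record opindexed_category (B : category) (fibre : B -> category) :=
  OpindexedCategory {
    reindex : forall a b : B, hom a b -> functor (fibre a) (fibre b);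
    reindex_id : forall a : B, reindex (idm a) = functor_id (fibre a);
    reindex_comp : forall (a b c : B) (g : hom b c) (f : hom a b),
      reindex (g ∘ f) = functor_comp (reindex g) (reindex f) }.

Arguments reindex {_ _} _ {_ _} _.

Definition doubly_opindexed_category (B C : category)
  (fibre : B -> C -> category) : Type :=
  @opindexed_category (prod_cat B C) (fun x => fibre (fst x) (snd x)).

Record terminal (C : category) := Terminal {
  one : C;
  bang : forall a : C, hom a one;
  bang_unique : forall (a : C) (f g : hom a one), f = g }.

Record cartesian_closed (C : category) := CartesianClosed {
  cc_terminal : terminal C;
  cc_prod : C -> C -> C;
  cc_fst : forall a b, hom (cc_prod a b) a;
  cc_snd : forall a b, hom (cc_prod a b) b;
  cc_pair : forall c a b, hom c a -> hom c b -> hom c (cc_prod a b);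
  cc_fst_pair : forall c a b (f : hom c a) (g : hom c b),
    cc_fst a b ∘ cc_pair f g = f;
  cc_snd_pair : forall c a b (f : hom c a) (g : hom c b),
    cc_snd a b ∘ cc_pair f g = g;
  cc_pair_unique : forall c a b (h k : hom c (cc_prod a b)),
    cc_fst a b ∘ h = cc_fst a b ∘ k -> cc_snd a b ∘ h = cc_snd a b ∘ k -> h = k;
  cc_exp : C -> C -> C;
  cc_eval : forall a b, hom (cc_prod (cc_exp a b) a) b;
  cc_curry : forall c a b, hom (cc_prod c a) b -> hom c (cc_exp a b);
  cc_eval_curry : forall c a b (f : hom (cc_prod c a) b),
    cc_eval a b ∘ cc_pair (cc_curry f ∘ cc_fst c a) (cc_snd c a) = f;
  cc_curry_unique : forall c a b (g : hom c (cc_exp a b)),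
    cc_curry (cc_eval a b ∘ cc_pair (g ∘ cc_fst c a) (cc_snd c a)) = g }.

Lemma sval_inj (A : Type) (Q : A -> Prop) (x y : sig Q) :
  proj1_sig x = proj1_sig y -> x = y.
Proof. by case: x y => [x hx] [y hy] /= e; subst; congr exist; exact: proof_irrelevance. Qed.

Section Slice.
Variables (C : category) (X : C).

Record slice_ob := SliceOb { slice_dom : C; slice_map : hom slice_dom X }.

Definition slice_hom (a b : slice_ob) : Type :=
  {f : hom (slice_dom a) (slice_dom b) | slice_map b ∘ f = slice_map a}.

Definition slice_idm (a : slice_ob) : slice_hom a a :=
  exist _ (idm (slice_dom a)) (comp_idr (slice_map a)).

Lemma slice_compP (a b c : slice_ob) (g : slice_hom b c) (f : slice_hom a b) :
  slice_map c ∘ (proj1_sig g ∘ proj1_sig f) = slice_map a.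
Proof. by rewrite comp_assoc (proj2_sig g) (proj2_sig f). Qed.

Definition slice_comp (a b c : slice_ob) (g : slice_hom b c)
  (f : slice_hom a b) : slice_hom a c :=
  exist _ (proj1_sig g ∘ proj1_sig f) (slice_compP g f).

Lemma slice_idl a b (f : slice_hom a b) : slice_comp (slice_idm b) f = f.
Proof. by apply: sval_inj; rewrite /= comp_idl. Qed.

Lemma slice_idr a b (f : slice_hom a b) : slice_comp f (slice_idm a) = f.
Proof. by apply: sval_inj; rewrite /= comp_idr. Qed.

Lemma slice_assoc a b c d (h : slice_hom c d) (g : slice_hom b c)
  (f : slice_hom a b) :
  slice_comp h (slice_comp g f) = slice_comp (slice_comp h g) f.
Proof. by apply: sval_inj; rewrite /= comp_assoc. Qed.

Definition slice : category :=
  @Category slice_ob slice_hom slice_idm slice_comp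
    slice_idl slice_idr slice_assoc.
End Slice.

Arguments SliceOb {C X slice_dom} slice_map.

Record lccc := Lccc {
  lccc_cat :> category;
  lccc_terminal : terminal lccc_cat;
  lccc_slice : forall X : lccc_cat, cartesian_closed (slice X) }.

Definition pt (E : lccc) : E := one (lccc_terminal E).
Definition to_pt (E : lccc) (a : E) : hom a (pt E) := bang (lccc_terminal E) a.

(* The pullback of f and g is the product of f and g in the slice over X. *)
Section Pullback.
Variables (E : lccc) (X A B : E) (f : hom A X) (g : hom B X).

Definition pb_slice : slice X :=
  cc_prod (lccc_slice X) (SliceOb f) (SliceOb g).

Definition pb : E := slice_dom pb_slice.

Definition pb1 : hom pb A :=
  proj1_sig (cc_fst (lccc_slice X) (SliceOb f) (SliceOb g)).

Definition pb2 : hom pb B :=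
  proj1_sig (cc_snd (lccc_slice X) (SliceOb f) (SliceOb g)).

Lemma pb_comm : f ∘ pb1 = g ∘ pb2.
Proof.
rewrite /pb1 /pb2.
rewrite (proj2_sig (cc_fst (lccc_slice X) (SliceOb f) (SliceOb g))).
by rewrite (proj2_sig (cc_snd (lccc_slice X) (SliceOb f) (SliceOb g))).
Qed.

Definition pb_pair (W : E) (h : hom W A) (k : hom W B) (e : f ∘ h = g ∘ k) :
  hom W pb :=
  proj1_sig (@cc_pair _ (lccc_slice X) (SliceOb (f ∘ h))
    (SliceOb f) (SliceOb g) (exist _ h erefl) (exist _ k (esym e))).

Lemma pb1_pair W (h : hom W A) (k : hom W B) (e : f ∘ h = g ∘ k) :
  pb1 ∘ pb_pair e = h.
Proof.
exact: (f_equal (@proj1_sig _ _) (@cc_fst_pair _ (lccc_slice X)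
  (SliceOb (f ∘ h)) (SliceOb f) (SliceOb g)
  (exist _ h erefl) (exist _ k (esym e)))).
Qed.

Lemma pb2_pair W (h : hom W A) (k : hom W B) (e : f ∘ h = g ∘ k) :
  pb2 ∘ pb_pair e = k.
Proof.
exact: (f_equal (@proj1_sig _ _) (@cc_snd_pair _ (lccc_slice X)
  (SliceOb (f ∘ h)) (SliceOb f) (SliceOb g)
  (exist _ h erefl) (exist _ k (esym e)))).
Qed.

Lemma pb_ext W (u v : hom W pb) :
  pb1 ∘ u = pb1 ∘ v -> pb2 ∘ u = pb2 ∘ v -> u = v.
Proof.
move=> e1 e2.
have hv : slice_map pb_slice ∘ v = slice_map pb_slice ∘ u.
  rewrite -(proj2_sig (cc_fst (lccc_slice X) (SliceOb f) (SliceOb g))) /=.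
  by rewrite -!comp_assoc -/pb1 e1.
pose u' : @hom (slice X) (SliceOb (slice_map pb_slice ∘ u)) pb_slice :=
  exist _ u erefl.
pose v' : @hom (slice X) (SliceOb (slice_map pb_slice ∘ u)) pb_slice :=
  exist _ v hv.
have e : u' = v' by apply: cc_pair_unique; apply: sval_inj.
exact: (f_equal (@proj1_sig _ _) e).
Qed.
End Pullback.

Section Product.
Variable E : lccc.

Definition prd (A B : E) : E := pb (to_pt A) (to_pt B).
Definition prd1 (A B : E) : hom (prd A B) A := pb1 (to_pt A) (to_pt B).
Definition prd2 (A B : E) : hom (prd A B) B := pb2 (to_pt A) (to_pt B).

Definition prd_pair (W A B : E) (h : hom W A) (k : hom W B) : hom W (prd A B) :=
  pb_pair (bang_unique (to_pt A ∘ h) (to_pt B ∘ k)).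

Definition prd_map (A B A' B' : E) (h : hom A A') (k : hom B B') :
  hom (prd A B) (prd A' B') := prd_pair (h ∘ prd1 A B) (k ∘ prd2 A B).
End Product.

Record monad (C : category) := Monad {
  monad_functor :> functor C C;
  monad_unit : forall a, hom a (monad_functor a);
  monad_mult : forall a, hom (monad_functor (monad_functor a)) (monad_functor a);
  monad_unit_nat : forall a b (f : hom a b),
    fmap monad_functor f ∘ monad_unit a = monad_unit b ∘ f;
  monad_mult_nat : forall a b (f : hom a b),
    fmap monad_functor f ∘ monad_mult a
    = monad_mult b ∘ fmap monad_functor (fmap monad_functor f);
  monad_left_unit : forall a,
    monad_mult a ∘ monad_unit (monad_functor a) = idm (monad_functor a);
  monad_right_unit : forall a,
    monad_mult a ∘ fmap monad_functor (monad_unit a) = idm (monad_functor a);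
  monad_mult_assoc : forall a,
    monad_mult a ∘ fmap monad_functor (monad_mult a)
    = monad_mult a ∘ monad_mult (monad_functor a) }.

Record monoid (E : lccc) := Monoid {
  mon :> ob E;
  mon_unit : hom (pt E) mon;
  mon_mul : hom (prd mon mon) mon;
  mon_left_unit : mon_mul ∘ prd_pair (mon_unit ∘ to_pt mon) (idm mon) = idm mon;
  mon_right_unit : mon_mul ∘ prd_pair (idm mon) (mon_unit ∘ to_pt mon) = idm mon;
  mon_mul_assoc :
    mon_mul ∘ prd_map mon_mul (idm mon)
    = mon_mul ∘ prd_pair (prd1 mon mon ∘ prd1 (prd mon mon) mon)
        (mon_mul ∘ prd_map (prd2 mon mon) (idm mon)) }.

(* The polynomial sum_{i : p(1)} y^{p[i]}, given as the bundle [bundle p]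
   of total space [dirs p] = sum_i p[i] over [pos p] = p(1). *)
Record poly (E : lccc) := Poly {
  pos : E;
  dirs : E;
  bundle : hom dirs pos }.

Arguments bundle {_} _.

Definition section (E : lccc) (p : poly E) : Type :=
  {s : hom (pos p) (dirs p) | bundle p ∘ s = idm (pos p)}.

(* The family of backwards maps q[fwd i] -> p[i], for i : p(1), is a map over
   p(1) from the pullback of the bundle of q along [fwd] to the bundle of p. *)
Record poly_hom (E : lccc) (p q : poly E) := PolyHom {
  fwd : hom (pos p) (pos q);
  bwd : hom (pb fwd (bundle q)) (dirs p);
  bwd_over : bundle p ∘ bwd = pb1 fwd (bundle q) }.

Arguments fwd {_ _ _} _.
Arguments bwd {_ _ _} _.

Section PolyCategory.
Variable E : lccc.

Lemma pb_pair_eq (X A B : E) (f : hom A X) (g : hom B X) (W : E)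
  (h h' : hom W A) (k k' : hom W B) (e : f ∘ h = g ∘ k) (e' : f ∘ h' = g ∘ k') :
  h = h' -> k = k' -> pb_pair e = pb_pair e'.
Proof. by move=> eh ek; subst h' k'; rewrite (proof_irrelevance _ e e'). Qed.

Lemma poly_hom_ext (p q : poly E) (f g : poly_hom p q) :
  fwd f = fwd g ->
  (forall W (h : hom W (pos p)) (k : hom W (dirs q))
    (ef : fwd f ∘ h = bundle q ∘ k) (eg : fwd g ∘ h = bundle q ∘ k),
    bwd f ∘ pb_pair ef = bwd g ∘ pb_pair eg) -> f = g.
Proof.
case: f g => [f1 fb fo] [g1 gb go] /= e; subst g1 => H.
have e : fb = gb.
  have c : f1 ∘ pb1 f1 (bundle q) = bundle q ∘ pb2 f1 (bundle q) by exact: pb_comm.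
  have := H _ _ _ c c.
  have -> : pb_pair c = idm _.
    by apply: pb_ext; rewrite ?pb1_pair ?pb2_pair comp_idr.
  by rewrite !comp_idr.
by subst gb; rewrite (proof_irrelevance _ fo go).
Qed.

Lemma poly_idmP (p : poly E) :
  bundle p ∘ pb2 (idm (pos p)) (bundle p) = pb1 (idm (pos p)) (bundle p).
Proof. by rewrite -pb_comm comp_idl. Qed.

Definition poly_idm (p : poly E) : poly_hom p p := PolyHom (poly_idmP p).

Section Comp.
Variables (p q r : poly E) (g : poly_hom q r) (f : poly_hom p q).

Local Notation dom1 := (pb1 (fwd g ∘ fwd f) (bundle r)).
Local Notation dom2 := (pb2 (fwd g ∘ fwd f) (bundle r)).

Lemma poly_comp_inner : fwd g ∘ (fwd f ∘ dom1) = bundle r ∘ dom2.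
Proof. by rewrite comp_assoc; exact: pb_comm. Qed.

Lemma poly_comp_outer :
  fwd f ∘ dom1 = bundle q ∘ (bwd g ∘ pb_pair poly_comp_inner).
Proof. by rewrite comp_assoc bwd_over pb1_pair. Qed.

Lemma poly_compP : bundle p ∘ (bwd f ∘ pb_pair poly_comp_outer) = dom1.
Proof. by rewrite comp_assoc bwd_over pb1_pair. Qed.

(* backwards: (i, d) |-> f#_i (g#_{f_1 i} d) *)
Definition poly_comp : poly_hom p r := PolyHom poly_compP.

Lemma bwd_comp W (h : hom W (pos p)) (k : hom W (dirs r))
  (e : fwd g ∘ fwd f ∘ h = bundle r ∘ k)
  (e1 : fwd g ∘ (fwd f ∘ h) = bundle r ∘ k)
  (e2 : fwd f ∘ h = bundle q ∘ (bwd g ∘ pb_pair e1)) :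
  bwd f ∘ pb_pair poly_comp_outer ∘ pb_pair e = bwd f ∘ pb_pair e2.
Proof.
rewrite -comp_assoc; congr (_ ∘ _); apply: pb_ext; rewrite comp_assoc.
  by rewrite !pb1_pair ?pb1_pair.
rewrite !pb2_pair -comp_assoc; congr (_ ∘ _).
apply: pb_ext; rewrite comp_assoc.
  by rewrite !pb1_pair -comp_assoc ?pb1_pair.
by rewrite !pb2_pair ?pb2_pair.
Qed.
End Comp.

Lemma poly_idl p q (f : poly_hom p q) : poly_comp (poly_idm q) f = f.
Proof.
apply: poly_hom_ext => [|W h k e1 e2]; first exact: comp_idl.
have c : fwd (poly_idm q) ∘ (fwd f ∘ h) = bundle q ∘ k by rewrite comp_assoc.
have c' : fwd f ∘ h = bundle q ∘ (bwd (poly_idm q) ∘ pb_pair c).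
  by rewrite /= pb2_pair.
rewrite (bwd_comp e1 c'); congr (_ ∘ _).
by apply: pb_pair_eq; rewrite ?pb2_pair.
Qed.

Lemma poly_idr p q (f : poly_hom p q) : poly_comp f (poly_idm p) = f.
Proof.
apply: poly_hom_ext => [|W h k e1 e2]; first exact: comp_idr.
have c : fwd f ∘ (fwd (poly_idm p) ∘ h) = bundle q ∘ k by rewrite comp_assoc.
have c' : fwd (poly_idm p) ∘ h = bundle p ∘ (bwd f ∘ pb_pair c).
  by rewrite comp_assoc bwd_over pb1_pair.
rewrite (bwd_comp e1 c') /= pb2_pair; congr (_ ∘ _).
by apply: pb_pair_eq; rewrite ?comp_idl.
Qed.

Lemma poly_assoc p q r s (h : poly_hom r s) (g : poly_hom q r)
  (f : poly_hom p q) : poly_comp h (poly_comp g f) = poly_comp (poly_comp h g) f.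
Proof.
apply: poly_hom_ext => [|W u k e1 e2]; first exact: comp_assoc.
have c1 : fwd h ∘ (fwd g ∘ (fwd f ∘ u)) = bundle s ∘ k.
  by rewrite -e1 /= !comp_assoc.
have c2 : fwd g ∘ (fwd f ∘ u) = bundle r ∘ (bwd h ∘ pb_pair c1).
  by rewrite (comp_assoc (bundle r)) bwd_over pb1_pair.
have c3 : fwd f ∘ u = bundle q ∘ (bwd g ∘ pb_pair c2).
  by rewrite (comp_assoc (bundle q)) bwd_over pb1_pair.
have d1 : fwd h ∘ (fwd (poly_comp g f) ∘ u) = bundle s ∘ k.
  by rewrite -e1 /= !comp_assoc.
have d2 : fwd (poly_comp g f) ∘ u = bundle r ∘ (bwd h ∘ pb_pair d1).
  by rewrite (comp_assoc (bundle r)) bwd_over pb1_pair.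
have d3 : fwd g ∘ (fwd f ∘ u) = bundle r ∘ (bwd h ∘ pb_pair d1).
  by rewrite -d2 /= comp_assoc.
have d4 : fwd f ∘ u = bundle q ∘ (bwd g ∘ pb_pair d3).
  by rewrite (comp_assoc (bundle q)) bwd_over pb1_pair.
have b1 : fwd (poly_comp h g) ∘ (fwd f ∘ u) = bundle s ∘ k.
  by rewrite -c1 /= !comp_assoc.
have b2 : fwd f ∘ u = bundle q ∘ (bwd (poly_comp h g) ∘ pb_pair b1).
  by rewrite (comp_assoc (bundle q)) bwd_over pb1_pair.
rewrite (bwd_comp e1 d2) (bwd_comp d2 d4) (bwd_comp e2 b2); congr (_ ∘ _).
apply: pb_pair_eq => //; rewrite (bwd_comp b1 c2); congr (_ ∘ _).
apply: pb_pair_eq => //; congr (_ ∘ _).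
by apply: pb_pair_eq => //=; rewrite comp_assoc.
Qed.

Definition PolyCat : category :=
  @Category (poly E) (@poly_hom E) poly_idm poly_comp poly_idl poly_idr
    poly_assoc.
End PolyCategory.

Section Actions.
Variables (E : lccc) (T : monoid E).

(* The map [a(t)] : X -> X, at a point t of T. *)
Definition at_time (X : E) (a : hom (prd T X) X) (t : hom (pt E) T) : hom X X :=
  a ∘ prd_pair (t ∘ to_pt X) (idm X).

(* a(0) = id and a(s + t) = a(s) ∘ a(t), the latter as an equation between maps
   T * (T * X) -> X. *)
Definition is_action (X : E) (a : hom (prd T X) X) : Prop :=
  at_time a (mon_unit T) = idm X /\
  a ∘ prd_pair (mon_mul T ∘ prd_map (idm T) (prd1 T X))
        (prd2 T X ∘ prd2 T (prd T X))
  = a ∘ prd_map (idm T) a.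

Definition equivariant (X Y : E) (a : hom (prd T X) X) (b : hom (prd T Y) Y)
  (f : hom X Y) : Prop := f ∘ a = b ∘ prd_map (idm T) f.

Lemma prd_map_id (A B : E) : prd_map (idm A) (idm B) = idm (prd A B).
Proof.
by apply: pb_ext; rewrite ?pb1_pair ?pb2_pair comp_idl comp_idr.
Qed.

Lemma prd_map_comp (A B B' B'' : E) (g : hom B' B'') (f : hom B B') :
  prd_map (idm A) (g ∘ f) = prd_map (idm A) g ∘ prd_map (idm A) f.
Proof.
apply: pb_ext; rewrite comp_assoc ?pb1_pair ?pb2_pair -comp_assoc.
  by rewrite pb1_pair !comp_idl.
by rewrite -comp_assoc pb2_pair.
Qed.

Lemma equivariant_id X (a : hom (prd T X) X) : equivariant a a (idm X).
Proof. by rewrite /equivariant prd_map_id comp_idl comp_idr. Qed.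

Lemma equivariant_comp X Y Z (a : hom (prd T X) X) (b : hom (prd T Y) Y)
  (c : hom (prd T Z) Z) (g : hom Y Z) (f : hom X Y) :
  equivariant b c g -> equivariant a b f -> equivariant a c (g ∘ f).
Proof.
rewrite /equivariant => eg ef.
by rewrite -comp_assoc ef comp_assoc eg -comp_assoc prd_map_comp.
Qed.
End Actions.

Arguments is_action {E} T {X} a.
Arguments equivariant {E} T {X Y} a b f.

Section MeasurePreserving.
Variables (E : lccc) (P : monad E) (T : monoid E).

Record mp_system := MpSystem {
  space : E;
  flow : hom (prd T space) space;
  flow_action : is_action T flow;
  measure : hom (pt E) (P space);
  measure_preserved : forall t : hom (pt E) T,
    fmap P (at_time flow t) ∘ measure = measure }.

Definition mp_hom (A B : mp_system) : Type :=
  {f : hom (space A) (space B) |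
    equivariant T (flow A) (flow B) f /\ fmap P f ∘ measure A = measure B}.

Lemma mp_idmP (A : mp_system) :
  equivariant T (flow A) (flow A) (idm (space A)) /\
  fmap P (idm (space A)) ∘ measure A = measure A.
Proof. by split; [exact: equivariant_id | rewrite fmap_id comp_idl]. Qed.

Definition mp_idm (A : mp_system) : mp_hom A A := exist _ _ (mp_idmP A).

Lemma mp_compP (A B C : mp_system) (g : mp_hom B C) (f : mp_hom A B) :
  equivariant T (flow A) (flow C) (proj1_sig g ∘ proj1_sig f) /\
  fmap P (proj1_sig g ∘ proj1_sig f) ∘ measure A = measure C.
Proof.
case: g f => [g [g1 g2]] [f [f1 f2]] /=; split; first exact: equivariant_comp f1.
by rewrite fmap_comp -comp_assoc f2.
Qed.

Definition mp_comp (A B C : mp_system) (g : mp_hom B C) (f : mp_hom A B) :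
  mp_hom A C := exist _ _ (mp_compP g f).

Lemma mp_idl A B (f : mp_hom A B) : mp_comp (mp_idm B) f = f.
Proof. by apply: sval_inj; rewrite /= comp_idl. Qed.

Lemma mp_idr A B (f : mp_hom A B) : mp_comp f (mp_idm A) = f.
Proof. by apply: sval_inj; rewrite /= comp_idr. Qed.

Lemma mp_assoc A B C D (h : mp_hom C D) (g : mp_hom B C) (f : mp_hom A B) :
  mp_comp h (mp_comp g f) = mp_comp (mp_comp h g) f.
Proof. by apply: sval_inj; rewrite /= comp_assoc. Qed.

Definition MpCat : category :=
  @Category mp_system mp_hom mp_idm mp_comp mp_idl mp_idr mp_assoc.
End MeasurePreserving.

Section OpenSystems.
Variables (E : lccc) (T : monoid E).

(* The domain sum_{t : T} sum_{s : S} p[out(t, s)] of [upd] is the pullback of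
   the bundle of p along [out]. *)
Record open_data (p : poly E) (Omega : E) := OpenData {
  state : E;
  proj : hom state Omega;
  out : hom (prd T state) (pos p);
  upd : hom (pb out (bundle p)) state }.

Arguments state {_ _} _.
Arguments proj {_ _} _.
Arguments out {_ _} _.
Arguments upd {_ _} _.

Section Closure.
Variables (p : poly E) (Omega : E) (X : open_data p Omega) (s : section p).

Lemma closureP :
  out X ∘ idm (prd T (state X)) = bundle p ∘ (proj1_sig s ∘ out X).
Proof. by rewrite comp_idr comp_assoc (proj2_sig s) comp_idl. Qed.

Definition closure : hom (prd T (state X)) (state X) :=
  upd X ∘ pb_pair closureP.
End Closure.

Section Reindexing.

Section Poly.
Variables (p q : poly E) (f : poly_hom p q) (Omega : E) (X : open_data p Omega).

Local Notation dom1 := (pb1 (fwd f ∘ out X) (bundle q)).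
Local Notation dom2 := (pb2 (fwd f ∘ out X) (bundle q)).

Lemma pull_bwd_inner : fwd f ∘ (out X ∘ dom1) = bundle q ∘ dom2.
Proof. by rewrite comp_assoc; exact: pb_comm. Qed.

Lemma pull_bwd_outer : out X ∘ dom1 = bundle p ∘ (bwd f ∘ pb_pair pull_bwd_inner).
Proof. by rewrite comp_assoc bwd_over pb1_pair. Qed.

(* (t, x, d) |-> (t, x, f#_{out(t, x)} d) *)
Definition pull_bwd :
  hom (pb (fwd f ∘ out X) (bundle q)) (pb (out X) (bundle p)) :=
  pb_pair pull_bwd_outer.

Definition open_along_poly : open_data q Omega :=
  @OpenData q Omega (state X) (proj X) (fwd f ∘ out X) (upd X ∘ pull_bwd).
End Poly.

Definition open_along_map (p : poly E) (Omega Omega' : E)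
  (f : hom Omega Omega') (X : open_data p Omega) : open_data p Omega' :=
  @OpenData p Omega' (state X) (f ∘ proj X) (out X) (upd X).
End Reindexing.

Variable P : monad E.

Section Category.
Variables (p : poly E) (theta : mp_system P T).

Definition is_open_rds (X : open_data p (space theta)) : Prop :=
  forall s : section p,
    is_action T (closure X s) /\
    equivariant T (closure X s) (flow theta) (proj X).

Record open_rds := OpenRds {
  rds_data :> open_data p (space theta);
  rds_axiom : is_open_rds rds_data }.

Definition rds_hom (X Y : open_rds) : Type :=
  {f : hom (state X) (state Y) |
    proj Y ∘ f = proj X /\
    forall s : section p, equivariant T (closure X s) (closure Y s) f}.

Lemma rds_idmP (X : open_rds) :
  proj X ∘ idm (state X) = proj X /\
  forall s : section p, equivariant T (closure X s) (closure X s) (idm (state X)).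
Proof. by split=> [|s]; [exact: comp_idr | exact: equivariant_id]. Qed.

Definition rds_idm (X : open_rds) : rds_hom X X := exist _ _ (rds_idmP X).

Lemma rds_compP (X Y Z : open_rds) (g : rds_hom Y Z) (f : rds_hom X Y) :
  proj Z ∘ (proj1_sig g ∘ proj1_sig f) = proj X /\
  forall s : section p,
    equivariant T (closure X s) (closure Z s) (proj1_sig g ∘ proj1_sig f).
Proof.
case: g f => [g [g1 g2]] [f [f1 f2]] /=; split=> [|s].
  by rewrite comp_assoc g1.
exact: equivariant_comp (f2 s).
Qed.

Definition rds_comp (X Y Z : open_rds) (g : rds_hom Y Z) (f : rds_hom X Y) :
  rds_hom X Z := exist _ _ (rds_compP g f).

Lemma rds_idl X Y (f : rds_hom X Y) : rds_comp (rds_idm Y) f = f.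
Proof. by apply: sval_inj; rewrite /= comp_idl. Qed.

Lemma rds_idr X Y (f : rds_hom X Y) : rds_comp f (rds_idm X) = f.
Proof. by apply: sval_inj; rewrite /= comp_idr. Qed.

Lemma rds_assoc X Y Z W (h : rds_hom Z W) (g : rds_hom Y Z) (f : rds_hom X Y) :
  rds_comp h (rds_comp g f) = rds_comp (rds_comp h g) f.
Proof. by apply: sval_inj; rewrite /= comp_assoc. Qed.

Definition RDyn : category :=
  @Category open_rds rds_hom rds_idm rds_comp rds_idl rds_idr rds_assoc.
End Category.
End OpenSystems.

Arguments RDyn {E} T P p theta.
Arguments rds_data {_ _ _ _ _} _.
Arguments open_along_poly {E T p q} f {Omega} X.
Arguments open_along_map {E T p Omega Omega'} f X.

Definition underlying (E : lccc) (T : monoid E) (P : monad E) (p : poly E)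
  (theta : mp_system P T) (X Y : RDyn T P p theta) (f : hom X Y) :
  hom (state (rds_data X)) (state (rds_data Y)) := proj1_sig f.

(* Main.v *)
(* Reindexing never touches state spaces or underlying maps, so everything
   reduces to equations between structure maps. Closing the system pushed
   forward along phi with a section s of q gives the same closed system as
   closing the original one with the section i |-> phi#_i (s (phi_1 i)) of p;
   hence the axioms of open systems and of their morphisms are inherited.
   Functoriality then follows from that of composition in Poly, tested on
   generalized elements of the pullbacks. *)
From Stdlib Require Import ssreflect ssrfun.
From Stdlib Require Import FunctionalExtensionality ProofIrrelevance.
Require Import Defs.

Set Implicit Arguments.
Unset Strict Implicit.
Unset Printing Implicit Defensive.

Local Open Scope cat_scope.

Arguments state {_ _ _ _} _.
Arguments proj {_ _ _ _} _.
Arguments out {_ _ _ _} _.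
Arguments upd {_ _ _ _} _.

(** Proof irrelevance makes dependent pairs injective, so packing loses nothing once the endpoints
    coincide. *)
Lemma arrow_inj (C : category) (a b : C) (f g : hom a b) :
  arrow f = arrow g -> f = g.
Proof. exact: inj_pair2. Qed.

(** * Sections pulled back along a polynomial morphism *)

Section PullSection.
Variables (E : lccc) (p q : poly E) (f : poly_hom p q) (s : section q).

Lemma pull_section_comm :
  fwd f ∘ idm (pos p) = bundle q ∘ (proj1_sig s ∘ fwd f).
Proof. by rewrite comp_assoc (proj2_sig s) comp_idl comp_idr. Qed.

Lemma pull_sectionP :
  bundle p ∘ (bwd f ∘ pb_pair pull_section_comm) = idm (pos p).
Proof. by rewrite comp_assoc bwd_over pb1_pair. Qed.

Definition pull_section : section p := exist _ _ pull_sectionP.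
End PullSection.

(** * Reindexing the data of open systems *)

Section OpenData.
Variables (E : lccc) (T : monoid E).

(** The type of the update depends on the output map. Testing on generalized elements [(h, k)]
    compares [u] with [u'] without a transport along [o = o']. *)
Lemma open_data_ext (p : poly E) (Omega S : E) (pi pi' : hom S Omega)
  (o o' : hom (prd T S) (pos p))
  (u : hom (pb o (bundle p)) S) (u' : hom (pb o' (bundle p)) S) :
  pi = pi' -> o = o' ->
  (forall W (h : hom W (prd T S)) (k : hom W (dirs p))
    (e : o ∘ h = bundle p ∘ k) (e' : o' ∘ h = bundle p ∘ k),
    u ∘ pb_pair e = u' ∘ pb_pair e') ->
  OpenData pi u = OpenData pi' u'.
Proof.
move=> epi eo; subst pi' o' => H; congr OpenData.
(* The generic element, given by the two projections, has the identity as its pairing. *)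
have c := pb_comm o (bundle p).
have c1 : pb_pair c = idm _.
  by apply: pb_ext; rewrite ?pb1_pair ?pb2_pair comp_idr.
by have := H _ _ _ c c; rewrite c1 !comp_idr.
Qed.

(** Evaluation rule for [pull_bwd], the analogue of [bwd_comp]. The commutation proofs [e1] and [e2]
    are arguments so that any available ones can be supplied. *)
Lemma pull_bwd_pair (p q : poly E) (f : poly_hom p q) (Omega : E)
  (X : open_data T p Omega) W (h : hom W (prd T (state X))) (k : hom W (dirs q))
  (e : fwd f ∘ out X ∘ h = bundle q ∘ k)
  (e1 : fwd f ∘ (out X ∘ h) = bundle q ∘ k)
  (e2 : out X ∘ h = bundle p ∘ (bwd f ∘ pb_pair e1)) :
  pull_bwd f X ∘ pb_pair e = pb_pair e2.
Proof.
apply: pb_ext; rewrite comp_assoc ?pb1_pair ?pb2_pair //.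
rewrite -comp_assoc; congr (_ ∘ _).
apply: pb_ext; rewrite comp_assoc ?pb1_pair ?pb2_pair //.
by rewrite -comp_assoc pb1_pair.
Qed.

Lemma closure_along_poly (p q : poly E) (f : poly_hom p q) (Omega : E)
  (X : open_data T p Omega) (s : section q) :
  closure (open_along_poly f X) s = closure X (pull_section f s).
Proof.
rewrite /closure /= -comp_assoc; congr (_ ∘ _).
have c1 : fwd f ∘ (out X ∘ idm (prd T (state X)))
    = bundle q ∘ (proj1_sig s ∘ (fwd f ∘ out X)).
  by rewrite comp_assoc; exact: (closureP (open_along_poly f X) s).
have c2 : out X ∘ idm (prd T (state X)) = bundle p ∘ (bwd f ∘ pb_pair c1).
  by rewrite (comp_assoc (bundle p)) bwd_over pb1_pair.
rewrite (pull_bwd_pair _ c2); apply: pb_pair_eq => //=.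
(* What remains is naturality of pairing: the pairing inside [pull_section], precomposed with
   [out X]. *)
rewrite -comp_assoc; congr (_ ∘ _).
apply: pb_ext; rewrite [RHS]comp_assoc ?pb1_pair ?pb2_pair.
  by rewrite comp_idl comp_idr.
by rewrite comp_assoc.
Qed.

(** [closure] does not consult [proj]; the two sides differ only in the commutation proof inside the
    pairing. *)
Lemma closure_along_map (p : poly E) (A B : E) (f : hom A B)
  (X : open_data T p A) (s : section p) :
  closure (open_along_map f X) s = closure X s.
Proof. by rewrite /closure; congr (_ ∘ _); apply: pb_pair_eq. Qed.

Lemma open_along_poly_id (p : poly E) (Omega : E) (X : open_data T p Omega) :
  open_along_poly (poly_idm p) X = X.
Proof.
case: X => S pi o u; apply: open_data_ext => //=; first exact: comp_idl.
move=> W h k e e'.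
have c1 : fwd (poly_idm p) ∘ (o ∘ h) = bundle p ∘ k by rewrite comp_assoc.
have c2 : o ∘ h = bundle p ∘ (bwd (poly_idm p) ∘ pb_pair c1).
  by rewrite /= pb2_pair.
rewrite -comp_assoc (@pull_bwd_pair _ _ _ _ (OpenData pi u) _ _ _ _ _ c2).
by congr (_ ∘ _); apply: pb_pair_eq => //=; rewrite pb2_pair.
Qed.

Lemma open_along_poly_comp (p q r : poly E) (g : poly_hom q r)
  (f : poly_hom p q) (Omega : E) (X : open_data T p Omega) :
  open_along_poly (poly_comp g f) X = open_along_poly g (open_along_poly f X).
Proof.
apply: open_data_ext => //=; first by rewrite comp_assoc.
move=> W h k e e'; rewrite -[LHS]comp_assoc -[RHS]comp_assoc -[RHS]comp_assoc.
congr (_ ∘ _).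
(* The [c] facts evaluate through the composite morphism, the [d] facts through [g] and then [f].
   Both routes reach the direction f#(g#(k)), up to bracketing. *)
have c1 : fwd g ∘ (fwd f ∘ (out X ∘ h)) = bundle r ∘ k.
  by rewrite -e !comp_assoc.
have c2 : fwd f ∘ (out X ∘ h) = bundle q ∘ (bwd g ∘ pb_pair c1).
  by rewrite (comp_assoc (bundle q)) bwd_over pb1_pair.
have c3 : fwd (poly_comp g f) ∘ (out X ∘ h) = bundle r ∘ k.
  by rewrite comp_assoc.
have c4 : out X ∘ h = bundle p ∘ (bwd (poly_comp g f) ∘ pb_pair c3).
  by rewrite (comp_assoc (bundle p)) bwd_over pb1_pair.
have d1 : fwd g ∘ (out (open_along_poly f X) ∘ h) = bundle r ∘ k.
  by rewrite comp_assoc.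
have d2 : out (open_along_poly f X) ∘ h = bundle q ∘ (bwd g ∘ pb_pair d1).
  by rewrite (comp_assoc (bundle q)) bwd_over pb1_pair.
have d3 : fwd f ∘ (out X ∘ h) = bundle q ∘ (bwd g ∘ pb_pair d1).
  by rewrite comp_assoc.
have d4 : out X ∘ h = bundle p ∘ (bwd f ∘ pb_pair d3).
  by rewrite (comp_assoc (bundle p)) bwd_over pb1_pair.
rewrite (pull_bwd_pair _ c4) (pull_bwd_pair _ d2) (pull_bwd_pair _ d4).
apply: pb_pair_eq => //; rewrite (bwd_comp c3 c2); congr (_ ∘ _).
apply: pb_pair_eq => //; congr (_ ∘ _).
by apply: pb_pair_eq => //=; rewrite comp_assoc.
Qed.

Lemma open_along_map_id (p : poly E) (Omega : E) (X : open_data T p Omega) :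
  open_along_map (idm Omega) X = X.
Proof. by case: X => S pi o u; rewrite /open_along_map /= comp_idl. Qed.

Lemma open_along_map_comp (p : poly E) (A B C : E) (g : hom B C) (f : hom A B)
  (X : open_data T p A) :
  open_along_map (g ∘ f) X = open_along_map g (open_along_map f X).
Proof. by rewrite /open_along_map /= comp_assoc. Qed.

(** One action changes only [proj], the other only [out] and [upd]. This interchange lets the two
    combine into an action of the product category. *)
Lemma open_along_poly_map (p q : poly E) (f : poly_hom p q) (A B : E)
  (m : hom A B) (X : open_data T p A) :
  open_along_poly f (open_along_map m X) = open_along_map m (open_along_poly f X).
Proof.
rewrite /open_along_poly /open_along_map /=.
congr (OpenData _ (_ ∘ _)).
apply: pb_pair_eq => //; congr (_ ∘ _); exact: pb_pair_eq.
Qed.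
End OpenData.

(** * Reindexing functors and their functoriality *)

Section RDynReindexing.
Variables (E : lccc) (P : monad E) (T : monoid E).

Lemma open_rds_ext (p : poly E) (theta : mp_system P T) (X Y : open_rds p theta) :
  rds_data X = rds_data Y -> X = Y.
Proof.
case: X Y => [X hX] [Y hY] /= e; subst Y; congr OpenRds.
exact: proof_irrelevance.
Qed.

(** The types of [fmap F f] and [fmap G f] agree only after [F] and [G] are identified on objects,
    hence the packed arrows. A morphism is then determined by its underlying map. *)
Lemma rdyn_functor_ext (C : category) (p : poly E) (theta : mp_system P T)
  (F G : functor C (RDyn T P p theta)) :
  (forall a, rds_data (F a) = rds_data (G a)) ->
  (forall a b (f : hom a b),
    arrow (underlying (fmap F f)) = arrow (underlying (fmap G f))) -> F = G.
Proof.
case: F G => [F0 F1 Fid Fcomp] [G0 G1 Gid Gcomp] /= eob ehom.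
have e0 : F0 = G0.
  by apply: functional_extensionality => a; apply: open_rds_ext.
subst G0; have e1 : F1 = G1.
  apply: functional_extensionality_dep => a.
  apply: functional_extensionality_dep => b.
  apply: functional_extensionality_dep => f.
  by apply: sval_inj; apply: arrow_inj; exact: ehom.
by subst G1; congr Functor; exact: proof_irrelevance.
Qed.

Section Along.
Variables (p q : poly E) (theta theta' : mp_system P T).
Variables (phi : poly_hom p q) (m : mp_hom theta theta').

Definition along_data (X : open_data T p (space theta)) :
  open_data T q (space theta') :=
  open_along_poly phi (open_along_map (proj1_sig m) X).

Lemma closure_along_data (X : open_data T p (space theta)) (s : section q) :
  closure (along_data X) s = closure X (pull_section phi s).
Proof. by rewrite closure_along_poly closure_along_map. Qed.

Lemma along_axiom (X : open_rds p theta) : is_open_rds (along_data (rds_data X)).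
Proof.
move=> s; rewrite closure_along_data.
have [act equ] := rds_axiom X (pull_section phi s); split=> //.
(* The new projection is the old one followed by [m], which preserves the flow. *)
exact: equivariant_comp (proj1 (proj2_sig m)) equ.
Qed.

Definition along_ob (X : RDyn T P p theta) : RDyn T P q theta' :=
  OpenRds (along_axiom X).

Lemma along_homP (X Y : RDyn T P p theta) (f : hom X Y) :
  proj (along_data (rds_data Y)) ∘ proj1_sig f = proj (along_data (rds_data X)) /\
  forall s : section q, equivariant T (closure (along_data (rds_data X)) s)
    (closure (along_data (rds_data Y)) s) (proj1_sig f).
Proof.
case: f => f [f1 f2]; split=> [|s] /=; first by rewrite -comp_assoc f1.
by rewrite !closure_along_data.
Qed.

Definition along_hom (X Y : RDyn T P p theta) (f : hom X Y) :
  hom (along_ob X) (along_ob Y) := exist _ (proj1_sig f) (along_homP f).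

Lemma along_hom_id (X : RDyn T P p theta) : along_hom (idm X) = idm (along_ob X).
Proof. exact: sval_inj. Qed.

Lemma along_hom_comp (X Y Z : RDyn T P p theta) (g : hom Y Z) (f : hom X Y) :
  along_hom (g ∘ f) = along_hom g ∘ along_hom f.
Proof. exact: sval_inj. Qed.

Definition along : functor (RDyn T P p theta) (RDyn T P q theta') :=
  Functor along_hom_id along_hom_comp.
End Along.

Definition rdyn_reindex (x y : prod_cat (PolyCat E) (MpCat P T)) (f : hom x y) :
  functor (RDyn T P (fst x) (snd x)) (RDyn T P (fst y) (snd y)) :=
  along (fst f) (snd f).

Lemma rdyn_reindex_id (x : prod_cat (PolyCat E) (MpCat P T)) :
  rdyn_reindex (idm x) = functor_id (RDyn T P (fst x) (snd x)).
Proof.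
(* The condition on morphisms holds by computation, since underlying maps are unchanged; only
   objects remain. *)
apply: rdyn_functor_ext => //= X.
by rewrite /along_data open_along_map_id open_along_poly_id.
Qed.

Lemma rdyn_reindex_comp (x y z : prod_cat (PolyCat E) (MpCat P T))
  (g : hom y z) (f : hom x y) :
  rdyn_reindex (g ∘ f) = functor_comp (rdyn_reindex g) (rdyn_reindex f).
Proof.
apply: rdyn_functor_ext => //= X.
rewrite /along_data open_along_map_comp open_along_poly_comp.
(* The system component of [g] must move past the polynomial component of [f]. *)
by rewrite (open_along_poly_map _ (proj1_sig (snd g))).
Qed.

Definition rdyn_opindexed :
  @doubly_opindexed_category (PolyCat E) (MpCat P T)
    (fun p theta => RDyn T P p theta) :=
  @OpindexedCategory (prod_cat (PolyCat E) (MpCat P T))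
    (fun x => RDyn T P (fst x) (snd x))
    rdyn_reindex rdyn_reindex_id rdyn_reindex_comp.
End RDynReindexing.

Theorem proposition2p27 (E : lccc) (P : monad E) (T : monoid E) :
  exists F : @doubly_opindexed_category (PolyCat E) (MpCat P T)
               (fun p theta => RDyn T P p theta),
    (forall (p q : PolyCat E) (phi : hom p q) (theta : MpCat P T),
       let F_phi : functor (RDyn T P p theta) (RDyn T P q theta) :=
         @reindex _ _ F (p, theta) (q, theta) (phi, idm theta) in
       (forall X : RDyn T P p theta,
          rds_data (F_phi X) = open_along_poly phi (rds_data X)) /\
       (forall (X Y : RDyn T P p theta) (f : hom X Y),
          arrow (underlying (fmap F_phi f)) = arrow (underlying f))) /\
    (forall (p : PolyCat E) (theta theta' : MpCat P T) (phi : hom theta theta'),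
       let F_phi : functor (RDyn T P p theta) (RDyn T P p theta') :=
         @reindex _ _ F (p, theta) (p, theta') (idm p, phi) in
       (forall X : RDyn T P p theta,
          rds_data (F_phi X) = open_along_map (proj1_sig phi) (rds_data X)) /\
       (forall (X Y : RDyn T P p theta) (f : hom X Y),
          arrow (underlying (fmap F_phi f)) = arrow (underlying f))).
Proof.
exists (rdyn_opindexed P T); split=> [p q phi theta | p theta theta' phi] /=.
  (* Fixing one variable is reindexing along its identity, which the matching identity law
     removes. *)
  by split=> // X; rewrite /along_data open_along_map_id.
by split=> // X; rewrite /along_data open_along_poly_id.
Qed.
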